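(* Let $\delta t>0$, let $u_h^0\in X_h$, and let $(\tilde u_h^{n+1},u_h^{n+1},\lambda_h^{n+1},\xi_h^{n+1})_{n\ge0}$, with $\xi_h^{n+1}\in\mathbb R$ independent of the spatial variable, be generated by the first-order positivity and mass preserving scheme: for each $n\ge0$, Step 1: $$\frac{\tilde u_h^{n+1}(\boldsymbol z)-u_h^n(\boldsymbol z)}{\delta t}+\mathcal L_h^n\tilde u_h^{n+1}(\boldsymbol z)=0,\qquad\forall\boldsymbol z\in\Sigma_h;$$ Step 2: $$\frac{u_h^{n+1}(\boldsymbol z)-\tilde u_h^{n+1}(\boldsymbol z)}{\delta t}=\lambda_h^{n+1}(\boldsymbol z)+\xi_h^{n+1},\qquad\forall\boldsymbol z\in\Sigma_h,$$ $$\lambda_h^{n+1}(\boldsymbol z)\ge0,\quad u_h^{n+1}(\boldsymbol z)\ge0,\quad\lambda_h^{n+1}(\boldsymbol z)u_h^{n+1}(\boldsymbol z)=0,\qquad\forall\boldsymbol z\in\Sigma_h,$$ $$[u_h^{n+1},1]=[u_h^n,1].$$ Assume that $\langle\mathcal L_h^n v_h,1\rangle=0$ for any $v_h\in X_h$ (and all $n$). Then for all $m\ge1$, $$\|u_h^m\|^2+\sum_{n=0}^{m-1}\left(\|\tilde u_h^{n+1}-u_h^n\|^2+\delta t^2\|\lambda_h^{n+1}+\xi_h^{n+1}\|^2\right)+2\delta t\sum_{n=0}^{m-1}\langle\mathcal L_h^n\tilde u_h^{n+1},\tilde u_h^{n+1}\rangle\le\|u_h^0\|^2 .$$ In particular,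 if for all $n$ one has $\langle\mathcal L_h^n v_h,v_h\rangle\ge0$ for all $v_h\in X_h$, then the scheme is dissipative and unconditionally stable, i.e. for every $\delta t>0$ (with no restriction on its size) $\|u_h^m\|\le\|u_h^0\|$ for all $m\ge1$.
   Context: $\Sigma_h$ is a finite set of mesh (collocation) points in $\bar\Omega$, and $X_h$ is a finite-dimensional space of real-valued functions such that for each $\boldsymbol z\in\Sigma_h$ there is a unique $\psi_{\boldsymbol z}\in X_h$ with $\psi_{\boldsymbol z}(\boldsymbol z')=\delta_{\boldsymbol z\boldsymbol z'}$ for all $\boldsymbol z'\in\Sigma_h$ (so functions in $X_h$ are identified with their values on $\Sigma_h$). Given weights $\omega_{\boldsymbol z}>0$, the discrete inner product and norm are $$[u,v]=\sum_{\boldsymbol z\in\Sigma_h}\omega_{\boldsymbol z}u(\boldsymbol z)v(\boldsymbol z),\qquad \|u\|=[u,u]^{1/2},$$ and $1$ denotes the constant function. For each $n\ge 0$, $\mathcal L_h^n$ is a given operator (linear or nonlinear) acting on $X_h$, an approximation at time $t_n$ of the spatial operator $\mathcal L$ in $u_t+\mathcal L u=0$; it may depend on previously computed quantities. $\langle\mathcal L_h^n v,w\rangle$ denotes the associated discrete form (after summation/integration by parts), which for $v\in X_h$ and $w\in X_h$ or $w=1$ represents the discrete inner product $[\mathcal L_h^n v,w]$; that is, the discrete inner product of Step 1 with such $w$ reads $\frac1{\delta t}[\tilde u_h^{n+1}-u_h^n,w]+\langle\mathcal L_h^n\tilde u_h^{n+1},w\rangle=0$. The functions $\tilde u_h^n,u_h^n,\lambda_h^n$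 are real-valued, determined by their values on $\Sigma_h$; in $\lambda_h^{n}+\xi_h^{n}$ the number $\xi_h^n$ is identified with a constant function. The solutions of the scheme are assumed to exist. *)

(* Defs.v *)
From HB Require Import structures.
From mathcomp Require Import all_boot all_order all_algebra.
From mathcomp Require Import finmap.
From mathcomp Require Import all_classical all_reals all_analysis.

Set Implicit Arguments.
Unset Strict Implicit.
Unset Printing Implicit Defensive.

Import Order.TTheory GRing.Theory Num.Theory.
Import numFieldNormedType.Exports.

Local Open Scope ring_scope.

Section Discrete.
Variables (R : realType) (T : choiceType).
Implicit Types (Sigma : {fset T}) (omega u v : T -> R).

Definition finite_dim (X : {pred (T -> R)}) : Prop :=
  exists (k : nat) (b : 'I_k -> T -> R),
    (forall i, b i \in X) /\
    (forall v, v \in X -> exists c : 'I_k -> R, v = \sum_(i < k) c i *: b i).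

Record nodal_space Sigma (X : {pred (T -> R)}) : Prop := NodalSpace {
  nodal_submod : submod_closed X;
  nodal_finite_dim : finite_dim X;
  nodal_basis : forall z, z \in Sigma ->
    exists! psi : T -> R,
      psi \in X /\ forall z', z' \in Sigma -> psi z' = (z == z')%:R }.

Definition dprod Sigma omega u v : R :=
  \sum_(z <- Sigma) omega z * u z * v z.

Definition dnorm Sigma omega u : R := Num.sqrt (dprod Sigma omega u u).

(* After summation by parts, the form of [L] agrees with [L v, w] for [v] in
   [X] and for [w] in [X] or [w = 1]; the constant 1 need not lie in [X]. *)
Definition represents Sigma omega (X : {pred (T -> R)})
    (L : (T -> R) -> (T -> R)) (form : (T -> R) -> (T -> R) -> R) : Prop :=
  forall v w, v \in X -> w \in X \/ w = cst 1 ->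
    form v w = dprod Sigma omega (L v) w.

(* [ut], [lam] and [xi] are only used at indices [n.+1].  Only the values of
   [u] and [lam] on [Sigma] matter, so these are not required to lie in [X],
   except for the initial datum; [ut n.+1] must, since [L n] acts on [X]. *)
Record scheme Sigma omega (X : {pred (T -> R)})
    (L : nat -> (T -> R) -> (T -> R)) (dt : R)
    (ut u lam : nat -> T -> R) (xi : nat -> R) : Prop := Scheme {
  scheme_init : u 0%N \in X;
  scheme_pred_mem : forall n, ut n.+1 \in X;
  scheme_predict : forall n z, z \in Sigma ->
    (ut n.+1 z - u n z) / dt + L n (ut n.+1) z = 0;
  scheme_correct : forall n z, z \in Sigma ->
    (u n.+1 z - ut n.+1 z) / dt = lam n.+1 z + xi n.+1;
  scheme_mult_ge0 : forall n z, z \in Sigma -> 0 <= lam n.+1 z;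
  scheme_sol_ge0 : forall n z, z \in Sigma -> 0 <= u n.+1 z;
  scheme_compl : forall n z, z \in Sigma -> lam n.+1 z * u n.+1 z = 0;
  scheme_mass : forall n,
    dprod Sigma omega (u n.+1) (cst 1) = dprod Sigma omega (u n) (cst 1) }.

End Discrete.

(* Main.v *)
(* Testing the prediction with [2 dt ut] gives
   |ut|^2 - |u|^2 + |ut - u|^2 + 2 dt <L ut, ut> = 0, and testing the correction
   with [2 dt u'] gives, by complementarity,
   |u'|^2 - |ut|^2 + dt^2 |lam + xi|^2 = 2 dt xi [u', 1].  Both steps conserve
   mass, so [lam + xi, 1] = 0; as [lam >= 0] this forces [xi <= 0], hence
   xi [u', 1] <= 0 because [u' >= 0]. *)
Require Import Defs.
From HB Require Import structures.
From mathcomp Require Import all_boot all_order all_algebra.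
From mathcomp Require Import finmap.
From mathcomp Require Import all_classical all_reals all_analysis.
From mathcomp Require Import ring lra.

Set Implicit Arguments.
Unset Strict Implicit.
Unset Printing Implicit Defensive.

Import Order.TTheory GRing.Theory Num.Theory.
Import numFieldNormedType.Exports.

Local Open Scope ring_scope.

Section DiscreteProduct.
Variables (R : realType) (T : choiceType) (Sigma : {fset T}) (omega : T -> R).
Hypothesis omega_gt0 : forall z, z \in Sigma -> 0 < omega z.
Implicit Types (f g u ut v lam : T -> R) (dt xi : R).

Lemma dprod_ge0 f g : (forall z, z \in Sigma -> 0 <= f z * g z) ->
  0 <= dprod Sigma omega f g.
Proof.
move=> fg_ge0; rewrite /dprod big_seq; apply: sumr_ge0 => z zS.
by rewrite -mulrA mulr_ge0 ?fg_ge0 // ltW ?omega_gt0.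
Qed.

Lemma sqr_dnorm f : dnorm Sigma omega f ^+ 2 = dprod Sigma omega f f.
Proof. by rewrite sqr_sqrtr // dprod_ge0 // => z _; rewrite -expr2 sqr_ge0. Qed.

Lemma le_dnorm f g :
  (dnorm Sigma omega f <= dnorm Sigma omega g) =
  (dnorm Sigma omega f ^+ 2 <= dnorm Sigma omega g ^+ 2).
Proof. by rewrite ler_pXn2r ?nnegrE ?sqrtr_ge0. Qed.

(** Each step of the scheme is an update [f2 + a * f3] known only at mesh points, hence the
    hypothesis restricted to [Sigma]; with [g] constant 1 this gives the mass balance of that
    step. *)
Lemma eq_dprod_affine f1 f2 f3 g a :
  (forall z, z \in Sigma -> f1 z = f2 z + a * f3 z) ->
  dprod Sigma omega f1 g
    = dprod Sigma omega f2 g + a * dprod Sigma omega f3 g.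
Proof.
move=> f1E; rewrite /dprod mulr_sumr -big_split; apply: eq_big_seq => z zS /=.
by rewrite f1E //; ring.
Qed.

Lemma multiplier_mass_le0 lam xi v :
  (forall z, z \in Sigma -> 0 <= lam z) ->
  (forall z, z \in Sigma -> 0 <= v z) ->
  dprod Sigma omega (lam + cst xi) (cst 1) = 0 ->
  xi * dprod Sigma omega v (cst 1) <= 0.
Proof.
move=> lam_ge0 u_ge0 mass0.
(* On an empty mesh the zero mass says nothing about the sign of [xi], but then the product vanishes
   anyway. *)
have [S0|[z zS]] := fset_0Vmem Sigma.
  by rewrite /dprod S0 big_seq_fset0 mulr0.
have xi_le0 : xi <= 0.
  rewrite leNgt; apply/negP => xi_gt0; move/eqP: mass0; apply/negP.
  have term_gt0 t : t \in Sigma -> 0 < omega t * (lam + cst xi) t * cst 1 t.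
    by move=> tS; rewrite mulr1 mulr_gt0 ?omega_gt0 ?ltr_wpDl ?lam_ge0.
  (* A sum of nonnegative terms is nonzero once one term is; the mesh point [z] supplies it. *)
  rewrite /dprod big_seq psumr_neq0; last by move=> t /term_gt0 /ltW.
  by apply/hasP; exists z; rewrite ?zS ?term_gt0.
by rewrite mulr_le0_ge0 // dprod_ge0 // => t tS; rewrite mulr1 u_ge0.
Qed.

(** The identity already holds at each mesh point before summation, so both energy balances are
    checked at once by eliminating [u] through [ut], then [ut] through [v]. *)
Lemma step_energy_identity u ut v lam Lut dt xi :
  (forall z, z \in Sigma -> ut z - u z = - dt * Lut z) ->
  (forall z, z \in Sigma -> v z - ut z = dt * (lam + cst xi) z) ->
  (forall z, z \in Sigma -> lam z * v z = 0) ->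
  dprod Sigma omega v v
    + (dprod Sigma omega (ut - u) (ut - u)
       + dt ^+ 2 * dprod Sigma omega (lam + cst xi) (lam + cst xi))
    + 2 * dt * dprod Sigma omega Lut ut
  = dprod Sigma omega u u + 2 * dt * (xi * dprod Sigma omega v (cst 1)).
Proof.
move=> predict correct compl.
rewrite /dprod !mulr_sumr -!big_split; apply: eq_big_seq => z zS /=.
have uE : u z = ut z + dt * Lut z by have := predict z zS; lra.
have utE : ut z = v z - dt * (lam z + xi).
  by rewrite -[lam z + xi]/((lam + cst xi) z) -correct //; ring.
have lam_u := compl z zS.
rewrite -[(lam + cst xi) z]/(lam z + xi) -[(ut - u) z]/(ut z - u z).
(* After elimination the two sides differ by [2 * dt * omega z * (lam z * v z)], which
   complementarity cancels. *)
rewrite /cst uE utE; ring: lam_u.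
Qed.

End DiscreteProduct.

Section SchemeStep.
Variables (R : realType) (T : choiceType) (Sigma : {fset T}) (omega : T -> R).
Variables (X : {pred (T -> R)}) (L : nat -> (T -> R) -> (T -> R)).
Variables (form : nat -> (T -> R) -> (T -> R) -> R) (dt : R).
Variables (ut u lam : nat -> T -> R) (xi : nat -> R).
Hypothesis omega_gt0 : forall z, z \in Sigma -> 0 < omega z.
Hypothesis formE : forall n, represents Sigma omega X (L n) (form n).
Hypothesis dt_gt0 : 0 < dt.
Hypothesis schemeP : scheme Sigma omega X L dt ut u lam xi.
Hypothesis form1 : forall n v, v \in X -> form n v (cst 1) = 0.

Let predict n z : z \in Sigma ->
  ut n.+1 z - u n z = - dt * L n (ut n.+1) z.
Proof.
move=> /(scheme_predict schemeP n) /eqP; rewrite addr_eq0 => /eqP eqL.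
by rewrite mulNr -mulrN -eqL mulrC divfK // gt_eqF.
Qed.

Let correct n z : z \in Sigma ->
  u n.+1 z - ut n.+1 z = dt * (lam n.+1 + cst (xi n.+1)) z.
Proof.
move=> /(scheme_correct schemeP n) eq_lam.
by rewrite -[(_ + cst _) z]/(lam n.+1 z + xi n.+1) -eq_lam mulrC divfK // gt_eqF.
Qed.

Lemma scheme_multiplier_mass n :
  dprod Sigma omega (lam n.+1 + cst (xi n.+1)) (cst 1) = 0.
Proof.
have utX := scheme_pred_mem schemeP n.
(* The test function is the constant 1, so the second alternative of [represents] applies. *)
have L1 : dprod Sigma omega (L n (ut n.+1)) (cst 1) = 0.
  by rewrite -formE ?form1 //; right.
have mass_ut : dprod Sigma omega (ut n.+1) (cst 1) = dprod Sigma omega (u n) (cst 1).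
  rewrite (@eq_dprod_affine _ _ _ _ _ (u n) (L n (ut n.+1)) _ (- dt)).
    by rewrite L1 mulr0 addr0.
  by move=> z zS; rewrite -predict // addrC subrK.
have := scheme_mass schemeP n.
rewrite (@eq_dprod_affine _ _ _ _ _ (ut n.+1) (lam n.+1 + cst (xi n.+1)) _ dt); last first.
  by move=> z zS; rewrite -correct // addrC subrK.
(* The masses of [u n] cancel, leaving [dt] times the mass of [lam + xi] equal to zero. *)
rewrite mass_ut => /eqP; rewrite -subr_eq0 addrAC subrr add0r mulf_eq0.
by rewrite (gt_eqF dt_gt0) => /eqP.
Qed.

Lemma scheme_step_energy n :
  dnorm Sigma omega (u n.+1) ^+ 2
    + (dnorm Sigma omega (ut n.+1 - u n) ^+ 2
       + dt ^+ 2 * dnorm Sigma omega (lam n.+1 + cst (xi n.+1)) ^+ 2)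
    + 2 * dt * form n (ut n.+1) (ut n.+1)
  <= dnorm Sigma omega (u n) ^+ 2.
Proof.
have utX := scheme_pred_mem schemeP n.
rewrite !(sqr_dnorm omega_gt0) formE //; last by left.
rewrite (step_energy_identity omega (predict n) (correct n) (scheme_compl schemeP n)).
(* The identity turns the left side into the old energy plus [2 * dt] times [xi] times the new mass;
   only the sign of this surplus is left. *)
rewrite gerDl mulr_ge0_le0 //; first by rewrite mulr_ge0 // ltW.
apply: multiplier_mass_le0 (scheme_multiplier_mass n) => // z zS.
- exact: scheme_mult_ge0 schemeP _ _ zS.
- exact: scheme_sol_ge0 schemeP _ _ zS.
Qed.

(** The one-step estimates telescope; the induction starts at [m = 0], where the sums are empty and
    equality holds. *)
Lemma scheme_energy m :
  dnorm Sigma omega (u m) ^+ 2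
    + \sum_(0 <= n < m)
        (dnorm Sigma omega (ut n.+1 - u n) ^+ 2
         + dt ^+ 2 * dnorm Sigma omega (lam n.+1 + cst (xi n.+1)) ^+ 2)
    + 2 * dt * (\sum_(0 <= n < m) form n (ut n.+1) (ut n.+1))
  <= dnorm Sigma omega (u 0%N) ^+ 2.
Proof.
elim: m => [|m IHm]; first by rewrite !big_nil mulr0 !addr0.
rewrite !big_nat_recr //=; apply: le_trans IHm.
rewrite mulrDr; have := scheme_step_energy m; lra.
Qed.

End SchemeStep.

Theorem theorem3p2 (R : realType) (d : nat) (Omega : set 'rV[R]_d)
  (Sigma : {fset (set_type (closure Omega))})
  (X : {pred (set_type (closure Omega) -> R)})
  (omega : set_type (closure Omega) -> R)
  (L : nat -> (set_type (closure Omega) -> R) -> (set_type (closure Omega) -> R))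
  (form : nat -> (set_type (closure Omega) -> R) ->
          (set_type (closure Omega) -> R) -> R)
  (dt : R)
  (ut u lam : nat -> set_type (closure Omega) -> R) (xi : nat -> R)
  (hX : nodal_space Sigma X)
  (homega : forall z, z \in Sigma -> 0 < omega z)
  (hL : forall n v, v \in X -> L n v \in X)
  (hform : forall n, represents Sigma omega X (L n) (form n))
  (hdt : 0 < dt)
  (hscheme : scheme Sigma omega X L dt ut u lam xi)
  (hmass : forall n v, v \in X -> form n v (cst 1) = 0) :
  (forall m : nat, (1 <= m)%N ->
     dnorm Sigma omega (u m) ^+ 2
     + \sum_(0 <= n < m)
         (dnorm Sigma omega (ut n.+1 - u n) ^+ 2
          + dt ^+ 2 * dnorm Sigma omega (lam n.+1 + cst (xi n.+1)) ^+ 2)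
     + 2 * dt * (\sum_(0 <= n < m) form n (ut n.+1) (ut n.+1))
     <= dnorm Sigma omega (u 0%N) ^+ 2)
  /\
  ((forall n v, v \in X -> 0 <= form n v v) ->
   forall m : nat, (1 <= m)%N ->
     dnorm Sigma omega (u m) <= dnorm Sigma omega (u 0%N)).
Proof.
have energy := scheme_energy homega hform hdt hscheme hmass.
split=> [m _|form_ge0 m _]; first exact: energy.
(* Norms are compared through their squares; what remains is that all the dissipation terms in the
   energy bound are nonnegative. *)
rewrite le_dnorm; apply: le_trans (energy m).
rewrite -addrA lerDl addr_ge0 //.
  by apply: sumr_ge0 => n _; rewrite addr_ge0 ?sqr_ge0 // mulr_ge0 ?sqr_ge0.
have dt2_ge0 : 0 <= 2 * dt by rewrite mulr_ge0 // ltW.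
rewrite mulr_ge0 //; apply: sumr_ge0 => n _.
exact: form_ge0 (scheme_pred_mem hscheme n).
Qed.
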